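(* Let $\mathcal{T}$ be the algebraic theory of groups, let $\mathbf{hTop}_\bullet$ be the homotopy category of pointed topological spaces, and let $\mathsf{S}^1$ be the pointed 1-sphere with its $\mathcal{T}$-coalgebra structure in $\mathbf{hTop}_\bullet$ described in the context. Then for all sets $n$, the object $(n\cdot\mathsf{S}^1,\pi_1(n\cdot\mathsf{S}^1))$ is $\zeta$-complete in $\mathrm{Aff}^*_{\mathsf{S}^1}(\mathcal{T},\mathbf{hTop}_\bullet)$, where $n\cdot\mathsf{S}^1$ is the $n$-th copower of $\mathsf{S}^1$ in $\mathbf{hTop}_\bullet$ and $\pi_1$ denotes the fundamental group.
   Context: $\mathbf{hTop}_\bullet=\mathbf{Top}_\bullet/\!\simeq$ has pointed topological spaces as objects and pointed (base-point preserving) homotopy classes of base-point preserving continuous maps as morphisms. Its coproducts are formed as in $\mathbf{Top}_\bullet$ (wedges $\vee$); $n\cdot X$ denotes the coproduct of $n$ copies of $X$. $\mathsf{S}^1=[0,1]/(0\sim1)$ with base point $0=1$. It is a cogroup in $\mathbf{hTop}_\bullet$ (a coalgebra for the theory $\mathcal{T}$ of groups) via the homotopy classes of $\gamma:\mathsf{S}^1\to\mathsf{S}^1\vee\mathsf{S}^1$, $\gamma(t)=(2t,0)$ for $t\le\frac12$ and $\gamma(t)=(2t-1,1)$ for $t\ge\frac12$ (where $\mathsf{S}^1\vee\mathsf{S}^1=(\mathsf{S}^1\times\{0\})+(\mathsf{S}^1\times\{1\})/((0,0)\sim(1,1))$), of $\tau:\mathsf{S}^1\to\mathsf{S}^1$,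 $\tau(t)=1-t$, and of the trivial map to the one-point space. The induced group structure on $\mathbf{hTop}_\bullet(\mathsf{S}^1,X)$, with multiplication $(a,b)\mapsto[a,b]\cdot\gamma$, is that of the fundamental group $\pi_1(X)$, so $\mathbf{hTop}_\bullet(\mathsf{S}^1,X)=\pi_1(X)$. $\mathrm{Aff}^*_{\mathsf{S}^1}(\mathcal{T},\mathbf{hTop}_\bullet)$ is the category whose objects are pairs $(X,A)$ with $X$ a pointed space and $A$ a subgroup of $\pi_1(X)$, and whose morphisms $f:(X,A)\to(Y,B)$ are morphisms $f:X\to Y$ in $\mathbf{hTop}_\bullet$ with $f\cdot a\in B$ for all $a\in A$. For an object $(X,A)$, let $j_a:\mathsf{S}^1\to A\cdot\mathsf{S}^1$ $(a\in A)$ be the coproduct injections, let $J_A=\langle j_a\mid a\in A\rangle\le\pi_1(A\cdot\mathsf{S}^1)$ be the generated subgroup, and let $\varepsilon=\varepsilon_{(X,A)}:A\cdot\mathsf{S}^1\to X$ be the morphism in $\mathbf{hTop}_\bullet$ with $\varepsilon\cdot j_a=a$ for all $a\in A$. The object $(X,A)$ is separating if any two morphisms $g,h:(X,A)\to(Y,B)$ with $g\cdot a=h\cdot a$ for all $a\in A$ are equal (equivalently, $\varepsilon$ is an epimorphism in $\mathbf{hTop}_\bullet$). It is $\zeta$-complete if $\varepsilon$ is a $\zeta$-closed regular epimorphism, that is: if $(X,A)$ is separating and every $f:A\cdot\mathsf{S}^1\to Y$ in $\mathbf{hTop}_\bullet$ such that for all $s,t\in J_A$, $\varepsilon\cdot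 s=\varepsilon\cdot t$ implies $f\cdot s=f\cdot t$, factors through $\varepsilon$ in $\mathbf{hTop}_\bullet$. *)

(* Defs.v *)
From HB Require Import structures.
From mathcomp Require Import all_boot all_order all_algebra generic_quotient.
From mathcomp Require Import all_classical all_reals.
From mathcomp Require Import topology normedtype homotopy.
From mathcomp Require Import lra.

Set Implicit Arguments.
Unset Strict Implicit.
Unset Printing Implicit Defensive.

Import Order.TTheory GRing.Theory Num.Theory.
Import numFieldNormedType.Exports.

Local Open Scope classical_set_scope.
Local Open Scope ring_scope.
Local Open Scope quotient_scope.

Lemma comp_continuous (T U V : topologicalType) (g : U -> V) (f : T -> U) :
  continuous g -> continuous f -> continuous (fun x => g (f x)).
Proof. by move=> gc fc x; apply: (continuous_comp (fc x)); exact: gc. Qed.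

Lemma pair_continuous (T U V : topologicalType) (f : T -> U) (g : T -> V) :
  continuous f -> continuous g -> continuous (fun x => (f x, g x)).
Proof. by move=> fc gc x; apply: cvg_pair; [exact: fc|exact: gc]. Qed.

Lemma fst_continuous (T U : topologicalType) : continuous (@fst T U).
Proof. by move=> x; exact: cvg_fst. Qed.

Lemma snd_continuous (T U : topologicalType) : continuous (@snd T U).
Proof. by move=> x; exact: cvg_snd. Qed.

Definition unit_interval (R : realType) : Type :=
  set_type (`[0, 1]%classic : set R).
HB.instance Definition _ (R : realType) :=
  Topological.copy (unit_interval R) (set_type (`[0, 1]%classic : set R)).

Section unit_interval.
Context {R : realType}.
Local Notation I := (unit_interval R).

Lemma clampP (x : R) : Num.max 0 (Num.min x 1) \in (`[0, 1]%classic : set R).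
Proof.
apply/mem_set; rewrite /= in_itv /= le_max lexx /= ge_max ler01 /=.
by rewrite ge_min lexx orbT.
Qed.

(* The retraction of the line onto the interval; it is only used to name the
   points 2t, 2t - 1, 1 - t of [0, 1] without carrying membership proofs. *)
Definition clamp (x : R) : I :=
  exist (fun y => y \in (`[0, 1]%classic : set R)) _ (clampP x).

Definition coord01 (t : I) : R := \val t.

Arguments clamp : simpl never.
Arguments coord01 : simpl never.

Lemma clampE (x : R) : 0 <= x <= 1 -> coord01 (clamp x) = x.
Proof.
by move=> /andP[x0 x1]; rewrite /coord01 /clamp /= (min_idPl x1) (max_idPr x0).
Qed.

Lemma unit_intervalP (t : I) : 0 <= coord01 t <= 1.
Proof. by have := set_mem (valP t); rewrite /= in_itv. Qed.

Lemma clampK (t : I) : clamp (coord01 t) = t.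
Proof. by apply/val_inj/clampE/unit_intervalP. Qed.

Lemma coord01_continuous : continuous coord01.
Proof. exact: initial_continuous. Qed.

Lemma continuous_clamp (T : topologicalType) (u : T -> R) :
  continuous u -> continuous (fun x => clamp (u x)).
Proof.
move=> uc; apply: continuous_comp_initial => x /=.
have cm : {for x, continuous (fun y => Num.min (u y) 1)}.
  by apply: (@continuous_min _ _ u (cst 1) x); [exact: uc|exact: cst_continuous].
by apply: (@continuous_max _ _ (cst 0) (fun y => Num.min (u y) 1) x) => //;
  exact: cst_continuous.
Qed.

Lemma paste_continuous (T U : topologicalType) (u : T -> R) (c : R)
    (f g : T -> U) :
  continuous u -> continuous f -> continuous g ->
  (forall x, u x = c -> f x = g x) ->
  continuous (fun x => if u x <= c then f x else g x).
Proof.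
move=> uc fc gc fg.
have cA : closed [set x | u x <= c].
  by apply: (preimage_closed (D := [set y | y <= c])) => [x _|];
    [exact: uc|exact: closed_le].
have cB : closed [set x | c <= u x].
  by apply: (preimage_closed (D := [set y | c <= y])) => [x _|];
    [exact: uc|exact: closed_ge].
apply/continuous_subspace_setT.
have -> : [set: T] = [set x | u x <= c] `|` [set x | c <= u x].
  apply/seteqP; split => // x _.
  by case: (leP (u x) c) => [|/ltW]; [left|right].
apply: withinU_continuous => //.
- apply: (@subspace_eq_continuous _ _ _ (f : subspace _ -> U));
    last exact: continuous_subspaceT.
  by move=> x /set_mem /= uxc; rewrite /from_subspace uxc.
- apply: (@subspace_eq_continuous _ _ _ (g : subspace _ -> U));
    last exact: continuous_subspaceT.
  by move=> x /set_mem /= cux; rewrite /from_subspace; case: ltgtP cux => // ucx _; exact/esym/fg.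
Qed.

Lemma unit_interval_compact : compact [set: I].
Proof.
have -> : [set: I] = clamp @` (`[0, 1]%classic : set R).
  apply/seteqP; split => // t _; exists (coord01 t); last exact: clampK.
  by rewrite /= in_itv; exact: unit_intervalP.
apply: continuous_compact; last exact: segment_compact.
by apply: continuous_subspaceT; apply: (@continuous_clamp R id) => x.
Qed.

Lemma unit_interval_hausdorff : hausdorff_space I.
Proof.
move=> s t st; apply/val_inj/Rhausdorff => A B As Bt.
have [u [Au Bu]] := st _ _ (coord01_continuous As) (coord01_continuous Bt).
by exists (coord01 u).
Qed.

End unit_interval.

Record ptmap (X Y : ptopologicalType) := PtMap {
  ptmap_fun :> X -> Y;
  ptmap_continuous : continuous ptmap_fun;
  ptmap_point : ptmap_fun point = point
}.

HB.instance Definition _ (X Y : ptopologicalType) := gen_eqMixin (ptmap X Y).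
HB.instance Definition _ (X Y : ptopologicalType) := gen_choiceMixin (ptmap X Y).

Lemma ptmap_eq (X Y : ptopologicalType) (f g : ptmap X Y) : f =1 g -> f = g.
Proof.
case: f g => [f fc fp] [g gc gp] /= /funext fg.
by subst g; rewrite (Prop_irrelevance fc gc) (Prop_irrelevance fp gp).
Qed.

Definition pid (X : ptopologicalType) : ptmap X X :=
  @PtMap X X idfun (fun=> cvg_id) erefl.

Definition pcst (X Y : ptopologicalType) : ptmap X Y :=
  @PtMap X Y (fun=> point) (@cst_continuous X Y point) erefl.

Section pcomp.
Context {X Y Z : ptopologicalType} (g : ptmap Y Z) (f : ptmap X Y).

Lemma pcomp_continuous : continuous (g \o f).
Proof.
by move=> x; apply: continuous_comp; exact: ptmap_continuous.
Qed.

Lemma pcomp_point : (g \o f) point = point.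
Proof. by rewrite /= !ptmap_point. Qed.

Definition pcomp : ptmap X Z := PtMap pcomp_continuous pcomp_point.
End pcomp.

Section homotopy.
Context {R : realType} {X Y : ptopologicalType}.
Local Notation I := (unit_interval R).

Definition phomotopic (f g : ptmap X Y) : Prop :=
  exists H : I * X -> Y,
    [/\ continuous H,
        forall x, H (clamp 0, x) = f x,
        forall x, H (clamp 1, x) = g x &
        forall t, H (t, point) = point].

Lemma phomotopic_refl f : phomotopic f f.
Proof.
exists (f \o snd); split => // [|t]; last exact: ptmap_point.
by apply: (comp_continuous (@ptmap_continuous _ _ f)); exact: snd_continuous.
Qed.

Lemma retime_continuous (H : I * X -> Y) (u : R -> R) :
  continuous H -> continuous u ->
  continuous (fun z : I * X => H (clamp (u (coord01 z.1)), z.2)).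
Proof.
move=> Hc uc; apply: (comp_continuous Hc).
apply: pair_continuous; last exact: snd_continuous.
apply: (@continuous_clamp R _ (fun z : I * X => u (coord01 z.1))).
by apply: (comp_continuous uc); apply: (comp_continuous coord01_continuous);
  exact: fst_continuous.
Qed.

Lemma phomotopic_sym f g : phomotopic f g -> phomotopic g f.
Proof.
move=> [H [Hc H0 H1 Hp]].
exists (fun z => H (clamp (1 - coord01 z.1), z.2)); split => /=.
- apply: (retime_continuous (u := fun r => 1 - r)) => // r.
  by apply: cvgB; [exact: cvg_cst|exact: cvg_id].
- by move=> x; rewrite clampE ?lexx ?ler01 // subr0.
- by move=> x; rewrite clampE ?lexx ?ler01 // subrr.
- by move=> t.
Qed.

Lemma phomotopic_trans f g h :
  phomotopic f g -> phomotopic g h -> phomotopic f h.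
Proof.
move=> [H [Hc H0 H1 Hp]] [K [Kc K0 K1 Kp]].
exists (fun z => if coord01 z.1 <= 2^-1 then H (clamp (2 * coord01 z.1), z.2)
                 else K (clamp (2 * coord01 z.1 - 1), z.2)); split => /=.
- have c2 : continuous (fun r : R => 2 * r).
    by move=> r; apply: cvgM; [exact: cvg_cst|exact: cvg_id].
  apply: (@paste_continuous R _ _ (fun z : I * X => coord01 z.1)).
  + by apply: (comp_continuous coord01_continuous); exact: fst_continuous.
  + exact: (retime_continuous (u := fun r => 2 * r)).
  + apply: (retime_continuous (u := fun r => 2 * r - 1)) => // r.
    by apply: cvgB; [exact: c2|exact: cvg_cst].
  + by move=> [t x] /= ->; rewrite divff ?pnatr_eq0 // subrr H1 K0.
- move=> x; rewrite clampE ?lexx ?ler01 //.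
  by rewrite invr_ge0 ler0n mulr0.
- move=> x; rewrite clampE ?lexx ?ler01 //.
  rewrite ifF; last by apply/negbTE; rewrite -ltNge; lra.
  by rewrite (_ : 2 * 1 - 1 = 1 :> R) //; lra.
- by move=> t; case: ifP.
Qed.

Definition phomotopicb (f g : ptmap X Y) : bool := `[< phomotopic f g >].

Lemma phomotopicb_refl : reflexive phomotopicb.
Proof. by move=> f; apply/asboolP; exact: phomotopic_refl. Qed.

Lemma phomotopicb_sym : symmetric phomotopicb.
Proof. by move=> f g; apply/asboolP/asboolP; exact: phomotopic_sym. Qed.

Lemma phomotopicb_trans : transitive phomotopicb.
Proof.
by move=> g f h /asboolP fg /asboolP gh; apply/asboolP/(phomotopic_trans fg).
Qed.

Definition phomotopy_rel :=
  EquivRel phomotopicb phomotopicb_refl phomotopicb_sym phomotopicb_trans.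

End homotopy.

Definition hTop (R : realType) (X Y : ptopologicalType) : Type :=
  {eq_quot @phomotopy_rel R X Y}.
HB.instance Definition _ R X Y := Choice.on (hTop R X Y).
HB.instance Definition _ R X Y := Quotient.on (hTop R X Y).

Section hTop.
Context {R : realType}.
Implicit Types X Y Z : ptopologicalType.

Definition hcls {X Y} (f : ptmap X Y) : hTop R X Y := \pi_(hTop R X Y) f.

Lemma hclsP X Y (f g : ptmap X Y) : hcls f = hcls g <-> @phomotopic R X Y f g.
Proof.
split=> [/eqmodP /asboolP //|fg]; apply/eqmodP; exact/asboolP.
Qed.

Lemma hcls_repr X Y (f : hTop R X Y) : hcls (repr f) = f.
Proof. exact: reprK. Qed.

Definition hid X : hTop R X X := hcls (pid X).

Definition hzero X Y : hTop R X Y := hcls (pcst X Y).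

Definition hcomp {X Y Z} (g : hTop R Y Z) (f : hTop R X Y) : hTop R X Z :=
  hcls (pcomp (repr g) (repr f)).

Lemma phomotopic_comp X Y Z (g g' : ptmap Y Z) (f f' : ptmap X Y) :
  @phomotopic R _ _ g g' -> @phomotopic R _ _ f f' ->
  @phomotopic R _ _ (pcomp g f) (pcomp g' f').
Proof.
move=> [K [Kc K0 K1 Kp]] [H [Hc H0 H1 Hp]].
exists (fun z => K (z.1, H z)); split => /=.
- apply: (comp_continuous Kc).
  by apply: pair_continuous => //; exact: fst_continuous.
- by move=> x; rewrite H0 K0.
- by move=> x; rewrite H1 K1.
- by move=> t; rewrite Hp Kp.
Qed.

Lemma hcompE X Y Z (g : ptmap Y Z) (f : ptmap X Y) :
  hcomp (hcls g) (hcls f) = hcls (pcomp g f).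
Proof.
by apply/hclsP/phomotopic_comp; apply/hclsP; exact: hcls_repr.
Qed.

Lemma hcompA X Y Z W (h : hTop R Z W) (g : hTop R Y Z) (f : hTop R X Y) :
  hcomp h (hcomp g f) = hcomp (hcomp h g) f.
Proof.
rewrite -(hcls_repr h) -(hcls_repr g) -(hcls_repr f) !hcompE.
by congr hcls; exact: ptmap_eq.
Qed.

Lemma hcomp1l X Y (f : hTop R X Y) : hcomp (hid Y) f = f.
Proof. by rewrite -[f]hcls_repr hcompE; congr hcls; exact: ptmap_eq. Qed.

Lemma hcomp1r X Y (f : hTop R X Y) : hcomp f (hid X) = f.
Proof. by rewrite -[f]hcls_repr hcompE; congr hcls; exact: ptmap_eq. Qed.

End hTop.

(* [pwedge] needs a pointed index type.  The copower of [X] indexed by [n] is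
   the wedge indexed by [option n] with one additional one-point summand; this
   covers an empty [n], for which the copower is the one-point space. *)

Definition one_point : Type := discrete_topology unit.
HB.instance Definition _ := Topological.on one_point.
HB.instance Definition _ := isPointed.Build one_point tt.

Section copower.
Context (n : choiceType) (X : ptopologicalType).

Definition copower_summand (o : option n) : ptopologicalType :=
  if o is Some _ then X else one_point.

Definition copower : Type := pwedge copower_summand.
HB.instance Definition _ := PointedTopological.on copower.

End copower.

Section copower_maps.
Context {n : choiceType} {X : ptopologicalType}.
Local Notation p0 := (fun o => @point (@copower_summand n X o)).

Definition pcoproj_fun (i : n) : X -> copower n X := wedge_lift p0 (i := Some i).

Lemma pcoproj_continuous i : continuous (pcoproj_fun i).
Proof. exact: (@wedge_lift_continuous _ _ p0 (Some i)). Qed.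

Lemma pcoproj_point i : pcoproj_fun i point = point.
Proof. exact: (@wedge_liftE _ _ p0 None point (Some i) point). Qed.

Definition pcoproj (i : n) : ptmap X (copower n X) :=
  PtMap (@pcoproj_continuous i) (pcoproj_point i).

Context {Y : ptopologicalType} (a : n -> ptmap X Y).

Definition pcopair_summand (o : option n) : copower_summand X o -> Y :=
  match o return copower_summand X o -> Y with
  | Some i => a i
  | None => fun=> point
  end.

Definition pcopair_fun : copower n X -> Y :=
  @wedge_fun _ _ p0 _ pcopair_summand.

Lemma pcopair_summand_point o : pcopair_summand (p0 o) = point.
Proof. by case: o => //= i; exact: ptmap_point. Qed.

Lemma pcopair_continuous : continuous pcopair_fun.
Proof.
apply: wedge_fun_continuous => [[i|]|i j]; last by rewrite !pcopair_summand_point.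
- exact: ptmap_continuous.
- exact: cst_continuous.
Qed.

Lemma pcopair_liftE o (x : copower_summand X o) :
  pcopair_fun (wedge_lift p0 x) = pcopair_summand x.
Proof.
by rewrite /pcopair_fun wedge_lift_funE // => i j; rewrite !pcopair_summand_point.
Qed.

Lemma pcopair_point : pcopair_fun point = point.
Proof. exact: (pcopair_liftE (p0 None)). Qed.

Definition pcopair : ptmap (copower n X) Y :=
  PtMap pcopair_continuous pcopair_point.

Lemma pcopairE i : pcomp pcopair (pcoproj i) = a i.
Proof. by apply: ptmap_eq => x /=; exact: (@pcopair_liftE (Some i)). Qed.

End copower_maps.

Section hcopower.
Context {R : realType} {n : choiceType} {X : ptopologicalType}.

Definition coproj (i : n) : hTop R X (copower n X) := hcls (pcoproj i).

Definition copair {Y : ptopologicalType} (a : n -> hTop R X Y) :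
    hTop R (copower n X) Y :=
  hcls (pcopair (fun i => repr (a i))).

Lemma copair_coproj (Y : ptopologicalType) (a : n -> hTop R X Y) i :
  hcomp (copair a) (coproj i) = a i.
Proof. by rewrite hcompE pcopairE hcls_repr. Qed.

Import ArrowAsCompactOpen.

Local Notation p0 := (fun o => @point (@copower_summand n X o)).
Local Notation I := (unit_interval R).

Lemma copair_unique (Y : ptopologicalType) (f g : hTop R (copower n X) Y) :
  (forall i, hcomp f (coproj i) = hcomp g (coproj i)) -> f = g.
Proof.
rewrite -(hcls_repr f) -(hcls_repr g); set f' := repr f; set g' := repr g => fg.
have /choice[H HP] : forall i, exists H : I * X -> Y,
    [/\ continuous H, forall x, H (clamp 0, x) = f' (pcoproj i x),
        forall x, H (clamp 1, x) = g' (pcoproj i x) &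
        forall t, H (t, point) = point].
  by move=> i; have := fg i; rewrite !hcompE => /hclsP.
pose h (o : option n) : copower_summand X o -> I -> Y :=
  match o return copower_summand X o -> I -> Y with
  | Some i => fun x t => H i (t, x)
  | None => fun=> fun=> point
  end.
have hp o : h o (p0 o) = fun=> point.
  case: o => [i|//] /=; apply/funext => t; have [_ _ _ ->] := HP i.
  by [].
pose G : wedge p0 -> (I -> Y) := @wedge_fun _ _ p0 _ h.
have GE o x : G (wedge_lift p0 x) = h o x.
  by rewrite /G wedge_lift_funE // => i j; rewrite !hp.
have wP (w : wedge p0) : exists o (x : copower_summand X o), w = wedge_lift p0 x.
  have : [set: wedge p0] w by [].
  by rewrite -wedgeTE => -[o _ [x _ <-]]; exists o, x.
have hc o : continuous (uncurry (h o)).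
  case: o => [i|] /=.
    have [Hc _ _ _] := HP i.
    rewrite (_ : uncurry _ = fun z => H i (z.2, z.1)).
      by apply: (comp_continuous Hc); apply: pair_continuous;
        [exact: snd_continuous|exact: fst_continuous].
    by apply/funext => -[].
  rewrite (_ : uncurry _ = fun=> point); first exact: cst_continuous.
  by apply/funext => -[].
have Gc : continuous (uncurry G).
  apply: continuous_uncurry.
  - move=> t _; rewrite withinET; exists setT; first exact: filterT.
    by split; [exact: unit_interval_compact|exact: closedT].
  - exact: unit_interval_hausdorff.
  - apply: wedge_fun_continuous => [o|i j]; last by rewrite !hp.
    by rewrite -[h o]uncurryK; exact/continuous_curry_fun/hc.
  - move=> w; have [o [x ->]] := wP w; rewrite GE.
    by rewrite -[h o]uncurryK; have [_] := continuous_curry (hc o); apply.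
apply/hclsP; exists (fun z => uncurry G (z.2, z.1)); split.
- by apply: (comp_continuous Gc); apply: pair_continuous;
    [exact: snd_continuous|exact: fst_continuous].
- move=> w /=; have [[i|] [x ->]] := wP w; rewrite GE /=.
    by have [_ -> _ _] := HP i.
  by case: x; exact/esym/(ptmap_point f').
- move=> w /=; have [[i|] [x ->]] := wP w; rewrite GE /=.
    by have [_ _ -> _] := HP i.
  by case: x; exact/esym/(ptmap_point g').
- by move=> t; exact: (congr1 (@^~ t) (GE None tt)).
Qed.
End hcopower.

Section circle.
Context {R : realType}.
Local Notation I := (unit_interval R).

Definition endpoint (t : I) : bool := (coord01 t == 0) || (coord01 t == 1).

Definition circle_relb (s t : I) : bool := (s == t) || (endpoint s && endpoint t).

Lemma circle_relb_refl : reflexive circle_relb.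
Proof. by move=> t; rewrite /circle_relb eqxx. Qed.

Lemma circle_relb_sym : symmetric circle_relb.
Proof. by move=> s t; rewrite /circle_relb eq_sym andbC. Qed.

Lemma circle_relb_trans : transitive circle_relb.
Proof.
move=> t s u /predU1P[->//|/andP[es et]] /predU1P[<-|/andP[_ eu]];
  by rewrite /circle_relb ?es ?et ?eu orbT.
Qed.

Definition circle_rel :=
  EquivRel circle_relb circle_relb_refl circle_relb_sym circle_relb_trans.

End circle.

Definition circle (R : realType) : Type :=
  quotient_topology {eq_quot @circle_rel R}.
HB.instance Definition _ R := Topological.on (circle R).
HB.instance Definition _ R := Quotient.on (circle R).
HB.instance Definition _ R :=
  isPointed.Build (circle R) (\pi_(circle R) (clamp 0)).

Section circle_maps.
Context {R : realType}.
Local Notation I := (unit_interval R).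
Local Notation S1 := (circle R).

Definition angle (t : I) : S1 := \pi_S1 t.

Lemma angle_continuous : continuous angle.
Proof. exact: pi_continuous. Qed.

Lemma angle0 : angle (clamp 0) = point.
Proof. by []. Qed.

Lemma angle1 : angle (clamp 1) = point.
Proof.
apply/eqmodP/orP; right; rewrite /endpoint !clampE ?lexx ?ler01 //.
by rewrite !eqxx orbT.
Qed.

Section circle_map.
Context {Y : ptopologicalType} (p : I -> Y).
Hypotheses (pc : continuous p) (p0 : p (clamp 0) = point)
  (p1 : p (clamp 1) = point).

Definition circle_map_fun : S1 -> Y := fun z => p (repr z).

Lemma circle_map_compat (s t : I) : angle s = angle t -> p s = p t.
Proof.
have ep (u : I) : endpoint u -> p u = point.
  by move=> /orP[] /eqP u01; rewrite -(clampK u) u01.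
by move=> /eqmodP /predU1P[->//|/andP[/ep -> /ep ->]].
Qed.

Lemma circle_map_angle t : circle_map_fun (angle t) = p t.
Proof. by apply: circle_map_compat; exact: reprK. Qed.

Lemma circle_map_continuous : continuous circle_map_fun.
Proof.
apply/quotient_continuous; rewrite (_ : _ \o _ = p) //.
by apply/funext => t; exact: circle_map_angle.
Qed.

Lemma circle_map_point : circle_map_fun point = point.
Proof. by rewrite -angle0 circle_map_angle. Qed.

Definition circle_map : ptmap S1 Y := PtMap circle_map_continuous circle_map_point.

End circle_map.

(* gamma : S1 -> S1 v S1; the summand (-, 0) is indexed by [false] and (-, 1)
   by [true]. *)
Definition gamma_loop (t : I) : copower bool S1 :=
  if coord01 t <= 2^-1 then pcoproj false (angle (clamp (2 * coord01 t)))
  else pcoproj true (angle (clamp (2 * coord01 t - 1))).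

Lemma gamma_loop_continuous : continuous gamma_loop.
Proof.
have c2 : continuous (fun t : I => 2 * coord01 t : R).
  apply: (@comp_continuous _ _ _ (fun r : R => 2 * r)) coord01_continuous => r.
  by apply: cvgM; [exact: cvg_cst|exact: cvg_id].
apply: (@paste_continuous R I _ coord01 2^-1
  (fun t => pcoproj false (angle (clamp (2 * coord01 t))))
  (fun t => pcoproj true (angle (clamp (2 * coord01 t - 1))))).
- exact: coord01_continuous.
- apply: (comp_continuous (@ptmap_continuous _ _ (pcoproj false))).
  by apply: (comp_continuous angle_continuous); exact: continuous_clamp.
- apply: (comp_continuous (@ptmap_continuous _ _ (pcoproj true))).
  apply: (comp_continuous angle_continuous); apply: continuous_clamp.
  apply: (@comp_continuous _ _ _ (fun r : R => r - 1)) c2 => r.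
  by apply: cvgB; [exact: cvg_id|exact: cvg_cst].
- move=> t ->; rewrite divff ?pnatr_eq0 // subrr angle0 angle1.
  by rewrite (ptmap_point (pcoproj true)) (ptmap_point (pcoproj false)).
Qed.

Lemma gamma_loop0 : gamma_loop (clamp 0) = point.
Proof.
rewrite /gamma_loop clampE ?lexx ?ler01 // invr_ge0 ler0n mulr0 angle0.
exact: ptmap_point.
Qed.

Lemma gamma_loop1 : gamma_loop (clamp 1) = point.
Proof.
rewrite /gamma_loop clampE ?lexx ?ler01 //.
rewrite ifF; last by apply/negbTE; rewrite -ltNge; lra.
rewrite (_ : 2 * 1 - 1 = 1 :> R) ?angle1; last by lra.
exact: ptmap_point.
Qed.

Definition cogroup_mul : hTop R S1 (copower bool S1) :=
  hcls (circle_map gamma_loop_continuous gamma_loop0 gamma_loop1).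

Definition tau_loop (t : I) : S1 := angle (clamp (1 - coord01 t)).

Lemma tau_loop_continuous : continuous tau_loop.
Proof.
apply: (comp_continuous angle_continuous); apply: continuous_clamp.
apply: (@comp_continuous _ _ _ (fun r : R => 1 - r)) coord01_continuous => r.
by apply: cvgB; [exact: cvg_cst|exact: cvg_id].
Qed.

Lemma tau_loop0 : tau_loop (clamp 0) = point.
Proof. by rewrite /tau_loop clampE ?lexx ?ler01 // subr0 angle1. Qed.

Lemma tau_loop1 : tau_loop (clamp 1) = point.
Proof. by rewrite /tau_loop clampE ?lexx ?ler01 // subrr angle0. Qed.

Definition cogroup_inv : hTop R S1 S1 :=
  hcls (circle_map tau_loop_continuous tau_loop0 tau_loop1).

Definition cogroup_one : hTop R S1 one_point := hzero S1 one_point.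

End circle_maps.

Section pi1.
Context {R : realType}.
Implicit Types X Y : ptopologicalType.

Definition pi1 X := hTop R (circle R) X.

Definition pi1_mul {X} (a b : pi1 X) : pi1 X :=
  hcomp (copair (fun i : bool => if i then b else a)) cogroup_mul.

Definition pi1_inv {X} (a : pi1 X) : pi1 X := hcomp a cogroup_inv.

Definition pi1_one {X} : pi1 X := hcomp (hzero one_point X) cogroup_one.

Definition is_subgroup {X} (A : set (pi1 X)) : Prop :=
  [/\ A pi1_one,
      forall a b, A a -> A b -> A (pi1_mul a b) &
      forall a, A a -> A (pi1_inv a)].

Lemma is_subgroup_setT X : is_subgroup [set: pi1 X].
Proof. by []. Qed.

Definition subgroup_generated {X} (G : set (pi1 X)) : set (pi1 X) :=
  smallest is_subgroup G.

End pi1.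
Arguments pi1 R X : clear implicits.

Record affObj (R : realType) := AffObj {
  aff_space :> ptopologicalType;
  aff_sub : set (pi1 R aff_space);
  aff_subP : is_subgroup aff_sub
}.

Arguments aff_sub {R} _ _.

Record affHom (R : realType) (X Y : affObj R) := AffHom {
  aff_map :> hTop R X Y;
  aff_mapP : forall a, aff_sub X a -> aff_sub Y (hcomp aff_map a)
}.

Section zeta.
Context {R : realType}.
Implicit Types X Y : affObj R.

Definition separating X : Prop :=
  forall Y (g h : affHom X Y),
    (forall a, aff_sub X a -> hcomp g a = hcomp h a) -> g = h.

Definition aff_copower X : ptopologicalType :=
  copower (set_type (aff_sub X)) (circle R).

Definition aff_coproj X (a : set_type (aff_sub X)) : pi1 R (aff_copower X) :=
  coproj a.

Definition aff_counit X : hTop R (aff_copower X) X :=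
  copair (fun a : set_type (aff_sub X) => val a).

Definition aff_J X : set (pi1 R (aff_copower X)) :=
  subgroup_generated (range (@aff_coproj X)).

Definition zeta_complete X : Prop :=
  separating X /\
  forall (Y : ptopologicalType) (f : hTop R (aff_copower X) Y),
    (forall s t, aff_J s -> aff_J t ->
       hcomp (aff_counit X) s = hcomp (aff_counit X) t ->
       hcomp f s = hcomp f t) ->
    exists f' : hTop R X Y, f = hcomp f' (aff_counit X).

End zeta.

Definition full_aff (R : realType) (X : ptopologicalType) : affObj R :=
  AffObj (@is_subgroup_setT R X).

(* Main.v *)
Require Import Defs.
From mathcomp Require Import all_boot all_order all_algebra generic_quotient.
From mathcomp Require Import all_classical all_reals.
From mathcomp Require Import topology normedtype homotopy.
From mathcomp Require Import lra.

Set Implicit Arguments.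
Unset Strict Implicit.
Unset Printing Implicit Defensive.

Import Order.TTheory GRing.Theory Num.Theory.
Import numFieldNormedType.Exports.

Local Open Scope classical_set_scope.
Local Open Scope ring_scope.
Local Open Scope quotient_scope.

Local Notation pcomp := Defs.pcomp.

(** Let [W] be the wedge of circles and [A] its whole fundamental group. The
    counit [A * S1 -> W] is a split epimorphism: the morphism [sec] sending the
    [i]-th circle of [W] to the summand named by the class of the [i]-th
    coprojection is a section of it. This makes the object separating, and
    leaves [f * sec] as the only candidate for a factor of [f] through the
    counit. That [f * sec * counit = f] can be tested on the summands: for a
    loop class [a] one has to compare [f * (sec * a)] with [f * j_a]. Both
    [sec * a] and [j_a] are sent to [a] by the counit, so the hypothesis on [f]
    applies as soon as [sec * a] lies in [J_A]. As [sec] sends coprojections to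
    generators of [J_A], this follows from the surjectivity half of van Kampen's
    theorem: the coprojections generate the fundamental group of [W]
    ([pi1_wedge_generated]).

    For the generation, a loop [p] in [W] is replaced by [q = wedge_pinch p],
    where [wedge_pinch] is homotopic to the identity and collapses a
    neighbourhood of the base point. Locally in time, [p] either stays in that
    neighbourhood, where [q] is constant, or stays off the base point, hence
    inside a single circle. Following the loop from time 0 to time 1
    ([real_induction]) cuts [q] into arcs that begin and end at the base point
    and that are constant or run in one circle. An arc of the second kind comes
    from a path of [p] in an open interval, so [q] lifts along [angle] to a path
    in [[0, 1]] between end points; a straight-line homotopy ([loop_reparam])
    makes it constant, a generator, or the inverse of one
    ([circle_arc_class]). *)

(** * Real functions and induction along the line *)

Section real_functions.
Context {R : realType} {T : topologicalType}.
Implicit Types u v : T -> R.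

Lemma continuous_add u v :
  continuous u -> continuous v -> continuous (fun x => u x + v x).
Proof. by move=> uc vc x; apply: cvgD; [exact: uc|exact: vc]. Qed.

Lemma continuous_mul u v :
  continuous u -> continuous v -> continuous (fun x => u x * v x).
Proof. by move=> uc vc x; apply: cvgM; [exact: uc|exact: vc]. Qed.

End real_functions.

(** Let [x] be the supremum of the times in [[0, 1]] at which [P] holds. It
    propagates from a time just before [x] to one just after, so [x] is 1 and is
    attained. *)
Lemma real_induction (R : realType) (P : R -> Prop) :
  P 0 ->
  (forall x, exists2 e, 0 < e & forall t t', 0 <= t -> t <= t' ->
     `|t - x| < e -> `|t' - x| < e -> P t -> P t') ->
  P 1.
Proof.
move=> P0 Ploc.
pose E : set R := [set t | 0 <= t <= 1 /\ P t].
have E0 : E 0 by split=> //; rewrite lexx ler01.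
have Esup : has_sup E.
  by split; [exists 0|exists 1 => t [/andP[]]].
have x0 : 0 <= sup E := sup_upper_bound Esup E0.
have x1 : sup E <= 1 by apply: ge_sup; [exists 0|move=> t [/andP[]]].
have [e e0 Pe] := Ploc (sup E).
have [t [/andP[t0 t1] Pt] xt] := sup_adherent e0 Esup.
have tx : t <= sup E by apply: sup_upper_bound => //; split=> //; rewrite t0.
have step t' : t <= t' -> t' < sup E + e -> P t'.
  move=> tt' t'e; apply: (Pe t) => //; rewrite ltr_norml; apply/andP; split; lra.
have [|lt1] := leP 1 (sup E + e / 2).
  by move=> le1; apply: step => //; lra.
have /(sup_upper_bound Esup) : E (sup E + e / 2).
  split; first by apply/andP; split; lra.
  by apply: step; lra.
by move=> ?; exfalso; lra.
Qed.

(** * Loops and their classes *)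

Section loops.
Context {R : realType}.
Local Notation I := (unit_interval R).
Local Notation S1 := (circle R).
Implicit Types X Y : ptopologicalType.

Lemma angle_surj (z : S1) : exists t : I, z = angle t.
Proof. by exists (repr z); rewrite /angle reprK. Qed.

Lemma ptmap_circle_eq Y (g g' : ptmap S1 Y) :
  (forall t, g (angle t) = g' (angle t)) -> g = g'.
Proof. by move=> gg'; apply: ptmap_eq => z; have [t ->] := angle_surj z. Qed.

Lemma coord01_clamp0 : coord01 (clamp 0) = 0 :> R.
Proof. by rewrite clampE // lexx ler01. Qed.

Lemma coord01_clamp1 : coord01 (clamp 1) = 1 :> R.
Proof. by rewrite clampE // lexx ler01. Qed.

Lemma angle_eq_point (t : I) :
  angle t = point <-> coord01 t = 0 \/ coord01 t = 1.
Proof.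
split=> [/eqmodP /predU1P[->|/andP[/orP[] /eqP]]|[]].
- by left; exact: coord01_clamp0.
- by left.
- by right.
- by move=> t0; rewrite -(clampK t) t0 angle0.
- by move=> t1; rewrite -(clampK t) t1 angle1.
Qed.

Lemma angle_clamp_continuous : continuous (fun x : R => angle (clamp x)).
Proof.
apply: (comp_continuous angle_continuous).
by apply: (@continuous_clamp R R id) => x; exact: cvg_id.
Qed.

Import ArrowAsCompactOpen.

(** Homotopies of loops are given on [I * I]; they descend to [I * S1] because
    the product of a quotient map with the compact Hausdorff space [I] is again a
    quotient map. The descent is done on the curried map into the compact-open
    function space, where only the quotient property of [S1] is needed. *)
Lemma loop_homotopy Y (g g' : ptmap S1 Y) (H : I -> I -> Y) :
  continuous (fun z : I * I => H z.1 z.2) ->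
  (forall r, H (clamp 0) r = g (angle r)) ->
  (forall r, H (clamp 1) r = g' (angle r)) ->
  (forall t, H t (clamp 0) = point) -> (forall t, H t (clamp 1) = point) ->
  @hcls R _ _ g = hcls g'.
Proof.
move=> Hc H0 H1 Hl Hr.
pose K (r t : I) := H t r.
have Kc : continuous (uncurry K).
  rewrite (_ : uncurry K = fun z => H z.2 z.1); last by apply/funext => -[].
  apply: (@comp_continuous _ _ _ (fun z : I * I => H z.1 z.2)
    (fun z : I * I => (z.2, z.1))) => //.
  by apply: pair_continuous; [exact: snd_continuous|exact: fst_continuous].
pose G (z : S1) : I -> Y := K (repr z).
have GE r : G (angle r) = K r.
  have /eqmodP /predU1P[e|/andP[er es]] : angle (repr (angle r)) = angle r.
    exact: reprK.
    by rewrite /G; congr K.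
  have ep (u : I) : endpoint u -> K u = fun=> point.
    move=> /orP[] /eqP u01; apply/funext => t; rewrite /K -(clampK u) u01 //.
  by rewrite /G !ep.
have Gc : continuous (uncurry G).
  apply: continuous_uncurry.
  - move=> t _; rewrite withinET; exists setT; first exact: filterT.
    by split; [exact: unit_interval_compact|exact: closedT].
  - exact: unit_interval_hausdorff.
  - apply/quotient_continuous; rewrite (_ : _ \o _ = K); last first.
      by apply/funext => r; exact: GE.
    by rewrite -[K]uncurryK; exact/continuous_curry_fun.
  - move=> z; have [r ->] := angle_surj z; rewrite GE.
    by rewrite -[K]uncurryK; have [_] := continuous_curry Kc; apply.
apply/hclsP; exists (fun z => uncurry G (z.2, z.1)); split.
- by apply: (comp_continuous Gc); apply: pair_continuous;
    [exact: snd_continuous|exact: fst_continuous].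
- by move=> z /=; have [r ->] := angle_surj z; rewrite GE /K H0.
- by move=> z /=; have [r ->] := angle_surj z; rewrite GE /K H1.
- by move=> t /=; rewrite -angle0 GE /K Hl.
Qed.

(** The straight-line homotopy between [u] and [v] keeps the ends fixed, and [q]
    carries it to [Y]. All homotopies of loops below are of this form. *)
Lemma loop_reparam Y (q : R -> Y) (u v : I -> R) (g g' : ptmap S1 Y) :
  continuous q -> continuous u -> continuous v ->
  u (clamp 0) = v (clamp 0) -> u (clamp 1) = v (clamp 1) ->
  (forall r, g (angle r) = q (u r)) -> (forall r, g' (angle r) = q (v r)) ->
  @hcls R _ _ g = hcls g'.
Proof.
move=> qc uc vc uv0 uv1 gE g'E.
apply: (@loop_homotopy _ _ _
  (fun t r => q (u r + coord01 t * (v r + -1 * u r)))).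
- apply: (comp_continuous qc).
  have uc2 := comp_continuous uc (@snd_continuous I I).
  have vc2 := comp_continuous vc (@snd_continuous I I).
  apply: continuous_add => //; apply: continuous_mul.
    exact: (comp_continuous (@coord01_continuous R) (@fst_continuous I I)).
  apply: continuous_add => //; apply: continuous_mul => //.
  exact: cst_continuous.
- by move=> r; rewrite coord01_clamp0 mul0r addr0 gE.
- by move=> r; rewrite coord01_clamp1 mul1r mulN1r addrC subrK g'E.
- by move=> t; rewrite -uv0 mulN1r subrr mulr0 addr0 -gE angle0 ptmap_point.
- by move=> t; rewrite -uv1 mulN1r subrr mulr0 addr0 -gE angle1 ptmap_point.
Qed.

Lemma hcomp_copair (n : choiceType) X Y Z (g : hTop R Y Z) (a : n -> hTop R X Y) :
  hcomp g (copair a) = copair (fun i => hcomp g (a i)).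
Proof.
by apply: copair_unique => i; rewrite -hcompA !copair_coproj.
Qed.

Lemma hcomp_pi1_mul X Y (g : hTop R X Y) (a b : pi1 R X) :
  hcomp g (pi1_mul a b) = pi1_mul (hcomp g a) (hcomp g b).
Proof.
rewrite /pi1_mul hcompA hcomp_copair; congr (hcomp (copair _) _).
by apply/funext => -[].
Qed.

Lemma hcomp_pi1_inv X Y (g : hTop R X Y) (a : pi1 R X) :
  hcomp g (pi1_inv a) = pi1_inv (hcomp g a).
Proof. exact: hcompA. Qed.

Lemma pi1_oneE X : pi1_one = hcls (pcst S1 X).
Proof.
by rewrite /pi1_one /hzero /cogroup_one hcompE; congr hcls; exact: ptmap_eq.
Qed.

Lemma hcomp_pi1_one X Y (g : hTop R X Y) : hcomp g pi1_one = pi1_one.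
Proof.
rewrite !pi1_oneE -(hcls_repr g) hcompE; congr hcls; apply: ptmap_eq => x /=.
exact: ptmap_point.
Qed.

Lemma is_subgroup_preimage X Y (g : hTop R X Y) (G : set (pi1 R Y)) :
  is_subgroup G -> is_subgroup [set a | G (hcomp g a)].
Proof.
move=> [G1 GM GV]; split=> [|a b|a] /=.
- by rewrite hcomp_pi1_one.
- by rewrite hcomp_pi1_mul; exact: GM.
- by rewrite hcomp_pi1_inv; exact: GV.
Qed.

(** The wedge of [g] and [h] composed with [gamma] is the concatenation on the
    nose, so the equality already holds between representatives. *)
Lemma pi1_mulE X (g h k : ptmap S1 X) :
  (forall t : I, k (angle t) =
     if coord01 t <= 2^-1 then g (angle (clamp (2 * coord01 t)))
     else h (angle (clamp (2 * coord01 t - 1)))) ->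
  pi1_mul (hcls g) (hcls h) = hcls k :> pi1 R X.
Proof.
move=> kE; rewrite /pi1_mul.
have -> : copair (fun i : bool => if i then hcls h else @hcls R _ _ g) =
    hcls (pcopair (fun i : bool => if i then h else g)).
  apply: copair_unique => i; rewrite copair_coproj hcompE pcopairE.
  by case: i.
rewrite /cogroup_mul hcompE; congr hcls; apply: ptmap_circle_eq => t.
rewrite kE [LHS]/= circle_map_angle ?gamma_loop0 ?gamma_loop1 // /gamma_loop.
have pE i z := congr1 (fun m : ptmap S1 X => m z)
  (pcopairE (fun i : bool => if i then h else g) i).
by case: ifP => _; exact: pE.
Qed.

(** A loop in the circle that lifts to a path on the line between the points 0
    and 1 is homotopic to the image of the affine path with the same ends: a
    constant, the identity or [tau]. *)
Lemma circle_arc_class (v : I -> R) (g : ptmap S1 S1) :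
  continuous v -> (forall r, g (angle r) = angle (clamp (v r))) ->
  v (clamp 0) = 0 \/ v (clamp 0) = 1 -> v (clamp 1) = 0 \/ v (clamp 1) = 1 ->
  [\/ hcls g = pi1_one :> pi1 R S1, hcls g = hid S1 :> pi1 R S1
    | hcls g = cogroup_inv :> pi1 R S1].
Proof.
move=> vc gE v0 v1.
have qc := @angle_clamp_continuous.
have idc := @coord01_continuous R.
have eq01 (u : I -> R) (g' : ptmap S1 S1) : continuous u ->
    v (clamp 0) = u (clamp 0) -> v (clamp 1) = u (clamp 1) ->
    (forall r, g' (angle r) = angle (clamp (u r))) -> @hcls R _ _ g = hcls g'.
  by move=> uc e0 e1 g'E; exact: (loop_reparam qc vc uc).
case: v0 v1 => v0 [] v1.
- apply: Or31; rewrite pi1_oneE; apply: (eq01 (fun=> 0)) => //.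
  exact: cst_continuous.
- apply: Or32; apply: (eq01 coord01) => //.
  + by rewrite coord01_clamp0.
  + by rewrite coord01_clamp1.
  + by move=> r; rewrite clampK.
- apply: Or33; apply: (eq01 (fun r => 1 + -1 * coord01 r)).
  + apply: continuous_add; first exact: cst_continuous.
    by apply: continuous_mul => //; exact: cst_continuous.
  + by rewrite coord01_clamp0 mulr0 addr0.
  + by rewrite coord01_clamp1 mulr1 subrr.
  + move=> r; rewrite [LHS]/= circle_map_angle ?tau_loop0 ?tau_loop1 //.
    by rewrite mulN1r.
- apply: Or31; rewrite pi1_oneE; apply: (eq01 (fun=> 1)) => //.
    exact: cst_continuous.
  by move=> r /=; rewrite angle1.
Qed.

End loops.

(** * Pinching the circle at its base point *)

Section circle_pinch.
Context {R : realType}.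
Local Notation I := (unit_interval R).
Local Notation S1 := (circle R).

(* After clamping, the middle half of the interval is stretched over all of it
   and the outer quarters are sent to the end points. *)
Let pinch_coord (t : I) : R := 2 * coord01 t + - 2^-1.

Let pinch_coord_continuous : continuous pinch_coord.
Proof.
apply: continuous_add; last exact: cst_continuous.
by apply: continuous_mul; [exact: cst_continuous|exact: coord01_continuous].
Qed.

Let pinch_loop (t : I) : S1 := angle (clamp (pinch_coord t)).

Let pinch_loop_continuous : continuous pinch_loop.
Proof.
apply: (comp_continuous angle_continuous).
exact/continuous_clamp/pinch_coord_continuous.
Qed.

Lemma clamp_le0 (x : R) : x <= 0 -> clamp x = clamp 0.
Proof.
move=> x0; apply/val_inj => /=.
rewrite (min_idPl (le_trans x0 ler01)) (min_idPl ler01) maxxx.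
exact/max_idPl.
Qed.

Lemma clamp_ge1 (x : R) : 1 <= x -> clamp x = clamp 1.
Proof. by move=> x1; apply/val_inj => /=; rewrite (min_idPr x1) minxx. Qed.

Let pinch_loop0 : pinch_loop (clamp 0) = point.
Proof.
rewrite /pinch_loop clamp_le0 ?angle0 // /pinch_coord coord01_clamp0; lra.
Qed.

Let pinch_loop1 : pinch_loop (clamp 1) = point.
Proof.
rewrite /pinch_loop clamp_ge1 ?angle1 // /pinch_coord coord01_clamp1; lra.
Qed.

Definition pinch : ptmap S1 S1 :=
  circle_map pinch_loop_continuous pinch_loop0 pinch_loop1.

Lemma pinchE (t : I) : pinch (angle t) = angle (clamp (2 * coord01 t + - 2^-1)).
Proof. exact: circle_map_angle pinch_loop0 pinch_loop1 t. Qed.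

Lemma pinch_hid : hcls pinch = hid S1 :> hTop R S1 S1.
Proof.
apply: (@loop_reparam R S1 (fun x => angle (clamp x))
  (fun t => coord01 (clamp (pinch_coord t))) coord01).
- exact: angle_clamp_continuous.
- apply: (comp_continuous coord01_continuous).
  exact/continuous_clamp/pinch_coord_continuous.
- exact: coord01_continuous.
- by rewrite clamp_le0 // /pinch_coord coord01_clamp0; lra.
- by rewrite clamp_ge1 // /pinch_coord coord01_clamp1; lra.
- by move=> t; rewrite pinchE clampK.
- by move=> t; rewrite clampK.
Qed.

Let bump_loop (t : I) : R := coord01 t * (1 + -1 * coord01 t).

Let bump_loop_continuous : continuous bump_loop.
Proof.
have cc := @coord01_continuous R.
apply: continuous_mul => //; apply: continuous_add; first exact: cst_continuous.
by apply: continuous_mul => //; exact: cst_continuous.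
Qed.

Let bump_loop0 : bump_loop (clamp 0) = point.
Proof. by rewrite /bump_loop coord01_clamp0 mul0r. Qed.

Let bump_loop1 : bump_loop (clamp 1) = point.
Proof. by rewrite /bump_loop coord01_clamp1 mulr1 subrr mulr0. Qed.

(** A continuous function that measures the distance to the base point: it
    provides the open sets needed below. *)
Definition circle_bump : ptmap S1 R :=
  @circle_map R R bump_loop bump_loop_continuous bump_loop0 bump_loop1.

Lemma bumpE (t : I) : circle_bump (angle t) = coord01 t * (1 + -1 * coord01 t).
Proof. exact: (@circle_map_angle R R bump_loop bump_loop0 bump_loop1). Qed.

Lemma bump_gt0 (z : S1) : z <> point <-> 0 < circle_bump z.
Proof.
have [t ->] := angle_surj z; rewrite bumpE.
have /andP[t0 t1] := unit_intervalP t.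
split=> [/angle_eq_point zp|b0 /angle_eq_point [] e]; last 2 first.
- by move: b0; rewrite e mul0r ltxx.
- by move: b0; rewrite e mulr1 subrr mulr0 ltxx.
have t0' : coord01 t != 0 by apply/eqP => e; apply: zp; left.
have t1' : coord01 t != 1 by apply/eqP => e; apply: zp; right.
apply: mulr_gt0; first by rewrite lt_def t0'.
by rewrite mulN1r subr_gt0 lt_def eq_sym t1'.
Qed.

(* 3/16 is the value of t (1 - t) at t = 1/4 and t = 3/4. *)
Lemma pinch_near_point (z : S1) : circle_bump z < 3 / 16 -> pinch z = point.
Proof.
have [t ->] := angle_surj z; rewrite bumpE pinchE => b.
have /andP[t0 t1] := unit_intervalP t.
have [t4|t4] := leP (coord01 t) (1 / 4).
  by rewrite clamp_le0 ?angle0 //; lra.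
have [t4'|t4'] := leP (3 / 4) (coord01 t).
  by rewrite clamp_ge1 ?angle1 //; lra.
exfalso; nra.
Qed.

Definition circle_coord (z : S1) : R := coord01 (repr z).

Lemma circle_coordK z : angle (clamp (circle_coord z)) = z.
Proof. by rewrite /circle_coord clampK /angle reprK. Qed.

(** The map [angle] is injective off the end points, hence an open subset of the
    open interval is saturated and has an open image. *)
Lemma circle_coord_continuous (z : S1) :
  z <> point -> {for z, continuous circle_coord}.
Proof.
move=> zp; apply: continuous_comp; last exact: coord01_continuous.
move=> A; rewrite nbhsE => -[O [Oo Oz] OA].
have reprI (t : I) : angle t <> point -> repr (angle t) = t.
  move=> tp; have /eqmodP /predU1P[//|/andP[_ et]] : angle (repr (angle t)) = angle t.
    exact: reprK.
  by case: tp; apply/angle_eq_point; move: et => /orP[] /eqP ->; [left|right].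
pose U : set S1 := [set x | O (repr x) /\ 0 < circle_bump x].
have Uo : open U.
  rewrite /open /=; rewrite /quotient_open.
  have -> : \pi_S1 @^-1` U = O `&` [set t : I | 0 < circle_bump (angle t)].
    apply/seteqP; split => t; rewrite /U /=; move=> [Ot b]; split => //.
      by rewrite -(reprI t) //; exact/bump_gt0.
    by have /bump_gt0/reprI e := b; rewrite -[X in O X]e in Ot.
  apply: openI => //.
  have bc : continuous (fun t : I => circle_bump (angle t)).
    exact: (comp_continuous (@ptmap_continuous _ _ circle_bump) angle_continuous).
  by apply: (@open_comp _ _ _ [set y : R | 0 < y]) => [t _|];
    [exact: bc|exact: open_gt].
rewrite nbhs_filterE nbhsE; exists U; first by split=> //; split => //; exact/bump_gt0.
by move=> x [/OA].
Qed.

End circle_pinch.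

(** * Arcs of a path whose class lies in a given subgroup *)

Section arcs.
Context {R : realType} {Y : ptopologicalType} (G : set (pi1 R Y)).
Local Notation I := (unit_interval R).
Local Notation S1 := (circle R).
Implicit Types q : R -> Y.

(** Asking for a pointed map that agrees with the affinely rescaled arc avoids
    carrying proofs that [q s] and [q t] are the base point: the existence of the
    map forces it. *)
Definition arc_in q (s t : R) : Prop :=
  exists2 g : ptmap S1 Y,
    G (hcls g) & forall r, g (angle r) = q (s + coord01 r * (t - s)).

Context (Gsub : is_subgroup G).

Lemma arc_in_cst q (s t : R) : s <= t ->
  (forall r, s <= r <= t -> q r = point) -> arc_in q s t.
Proof.
move=> st qp; exists (pcst S1 Y); first by rewrite -pi1_oneE; case: Gsub.
move=> r /=; rewrite qp //; have /andP[r0 r1] := unit_intervalP r.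
by apply/andP; split; nra.
Qed.

(** Concatenating the two rescaled arcs runs along [q] with a piecewise affine
    speed instead of a constant one. *)
Lemma arc_in_trans q (s t u : R) : continuous q ->
  arc_in q s t -> arc_in q t u -> arc_in q s u.
Proof.
move=> qc [g Gg gE] [h Gh hE].
have cc := @coord01_continuous R.
have qs : q s = point.
  by rewrite -(ptmap_point g) -angle0 gE coord01_clamp0 mul0r addr0.
have qt : q t = point.
  by rewrite -(ptmap_point h) -angle0 hE coord01_clamp0 mul0r addr0.
have qu : q u = point.
  by rewrite -(ptmap_point h) -angle1 hE coord01_clamp1 mul1r addrC subrK.
pose v (r : I) : R := s + coord01 r * (u - s).
pose w (r : I) : R := if coord01 r <= 2^-1 then s + 2 * coord01 r * (t - s)
  else t + (2 * coord01 r - 1) * (u - t).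
have affc (a b c d : R) :
    continuous (fun r : I => a + (b * coord01 r + c) * d).
  apply: continuous_add; first exact: cst_continuous.
  apply: continuous_mul; last exact: cst_continuous.
  apply: continuous_add; last exact: cst_continuous.
  by apply: continuous_mul => //; exact: cst_continuous.
have vc : continuous v.
  rewrite (_ : v = fun r => s + (1 * coord01 r + 0) * (u - s)) //.
  by apply/funext => r; rewrite mul1r addr0.
have wc : continuous w.
  apply: (@paste_continuous R I R coord01 2^-1
    (fun r => s + 2 * coord01 r * (t - s))
    (fun r => t + (2 * coord01 r - 1) * (u - t))) => //.
    rewrite (_ : (fun _ => _) = fun r => s + (2 * coord01 r + 0) * (t - s)) //.
    by apply/funext => r; rewrite addr0.
  by move=> r ->; lra.
have v0 : v (clamp 0) = s by rewrite /v coord01_clamp0 mul0r addr0.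
have v1 : v (clamp 1) = u by rewrite /v coord01_clamp1 mul1r addrC subrK.
have w0 : w (clamp 0) = s.
  by rewrite /w coord01_clamp0 invr_ge0 ler0n mulr0 mul0r addr0.
have w1 : w (clamp 1) = u.
  by rewrite /w coord01_clamp1 ifF; [lra|apply/negbTE; rewrite -ltNge; lra].
have qv0 : q (v (clamp 0)) = point by rewrite v0.
have qv1 : q (v (clamp 1)) = point by rewrite v1.
have qw0 : q (w (clamp 0)) = point by rewrite w0.
have qw1 : q (w (clamp 1)) = point by rewrite w1.
pose k := circle_map (comp_continuous qc wc) qw0 qw1.
have kE r : k (angle r) = q (w r) by exact: circle_map_angle qw0 qw1 r.
pose l := circle_map (comp_continuous qc vc) qv0 qv1.
have lE r : l (angle r) = q (v r) by exact: circle_map_angle qv0 qv1 r.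
exists l => //.
rewrite (@loop_reparam R Y q v w l k) ?v0 ?v1 //.
rewrite -(@pi1_mulE R Y g h k).
  by case: Gsub => _ + _; apply.
move=> r; rewrite kE /w; have /andP[r0 r1] := unit_intervalP r.
case: ifPn => [r2|]; last rewrite -ltNge => r2.
  by rewrite gE clampE //; apply/andP; split; lra.
by rewrite hE clampE //; apply/andP; split; lra.
Qed.

End arcs.

(** * The fundamental group of a wedge of circles *)

Section wedge_of_circles.
Context {R : realType} {n : choiceType}.
Local Notation I := (unit_interval R).
Local Notation S1 := (circle R).
Local Notation W := (copower n (circle R)).
Local Notation p0 := (fun o => @point (@copower_summand n S1 o)).

Lemma copower_cases (w : W) : w = point \/ exists i z, w = pcoproj i z.
Proof.
have : [set: wedge p0] w by [].
rewrite -wedgeTE => -[[i|] _ [x _ <-]]; first by right; exists i, x.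
by left; case: x.
Qed.

Lemma pcopair_coprojE (Y : ptopologicalType) (a : n -> ptmap S1 Y) i z :
  pcopair a (pcoproj i z) = a i z.
Proof. exact: (@pcopair_liftE n S1 Y a (Some i)). Qed.

(** Collapses all circles but the [i]-th one. The points that it does not send to
    the base point are those of the [i]-th circle off the base point, which is
    how these open sets are written below. *)
Definition pproj (i : n) : ptmap W S1 :=
  pcopair (fun j => if j == i then pid S1 else pcst S1 S1).

Lemma pprojK i z : pproj i (pcoproj i z) = z.
Proof. by rewrite pcopair_coprojE eqxx. Qed.

Lemma pproj_neq i w : pproj i w <> point -> w = pcoproj i (pproj i w).
Proof.
have [->|[j [z ->]]] := copower_cases w; first by rewrite ptmap_point.
rewrite pcopair_coprojE; have [->|_] := eqVneq j i; last by [].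
by [].
Qed.

Lemma pproj_neq_inj i j w :
  pproj i w <> point -> pproj j w <> point -> i = j.
Proof.
move=> wi wj; apply/eqP/negPn/negP => ij; apply: wj.
by rewrite (pproj_neq wi) pcopair_coprojE (negbTE ij).
Qed.

Definition wedge_pinch : ptmap W W :=
  pcopair (fun i => pcomp (pcoproj i) pinch).

Lemma wedge_pinch_hid : hcls wedge_pinch = hid W :> hTop R W W.
Proof.
apply: copair_unique => i; rewrite hcomp1l hcompE pcopairE -hcompE.
by rewrite pinch_hid hcomp1r.
Qed.

Definition wedge_bump : ptmap W R := pcopair (fun=> circle_bump).

Lemma wedge_pinch_near_point w : wedge_bump w < 3 / 16 -> wedge_pinch w = point.
Proof.
have [->|[i [z ->]]] := copower_cases w; first by move=> _; rewrite ptmap_point.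
rewrite !pcopair_coprojE => /pinch_near_point e.
by rewrite -(ptmap_point (pcoproj i)) -e.
Qed.

Lemma wedge_bump_gt0 w : 0 < wedge_bump w -> exists i, pproj i w <> point.
Proof.
have [->|[i [z ->]]] := copower_cases w.
  by rewrite ptmap_point ltxx.
by rewrite pcopair_coprojE => /bump_gt0 zp; exists i; rewrite pprojK.
Qed.

Context (G : set (pi1 R W)) (Gsub : is_subgroup G)
  (Gcoproj : forall i, G (coproj i)).

(** Off the base point [circle_coord] lifts [p] to the open unit interval; the
    clamped stretching of this lift is a lift [v] of the pinched path. It
    begins and ends at 0 or 1, as the pinched path begins and ends at the base
    point. *)
Lemma arc_in_circle (p : R -> W) (i : n) (s t : R) :
  continuous p -> s <= t ->
  (forall r, s <= r <= t -> pproj i (p r) <> point) ->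
  wedge_pinch (p s) = point -> wedge_pinch (p t) = point ->
  arc_in G (fun r => wedge_pinch (p r)) s t.
Proof.
move=> pc st pi ps pt.
have cc := @coord01_continuous R.
pose c (r : I) : R := s + coord01 r * (t - s).
have cst r : s <= c r <= t.
  by have /andP[r0 r1] := unit_intervalP r; rewrite /c; apply/andP; split; nra.
have cC : continuous c.
  apply: continuous_add; first exact: cst_continuous.
  by apply: continuous_mul => //; exact: cst_continuous.
have c0 : c (clamp 0) = s by rewrite /c coord01_clamp0 mul0r addr0.
have c1 : c (clamp 1) = t by rewrite /c coord01_clamp1 mul1r addrC subrK.
pose x (r : I) : S1 := pproj i (p (c r)).
have xc : continuous x.
  exact: (comp_continuous (@ptmap_continuous _ _ (pproj i)) (comp_continuous pc cC)).
have xp r : x r <> point by exact: pi.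
pose v (r : I) : R := coord01 (clamp (2 * circle_coord (x r) + - 2^-1)).
have vc : continuous v.
  apply: (comp_continuous cc); apply: continuous_clamp.
  apply: continuous_add; last exact: cst_continuous.
  apply: continuous_mul; first exact: cst_continuous.
  move=> r; apply: continuous_comp; first exact: xc.
  exact/circle_coord_continuous/xp.
have pinchv r : pinch (x r) = angle (clamp (v r)).
  have := pinchE (clamp (circle_coord (x r))).
  by rewrite circle_coordK clampE ?unit_intervalP // /v clampK.
have qE r : wedge_pinch (p (c r)) = pcoproj i (angle (clamp (v r))).
  by rewrite (pproj_neq (pi _ (cst r))) pcopair_coprojE /= -pinchv.
have vend r : wedge_pinch (p (c r)) = point -> v r = 0 \/ v r = 1.
  move=> /(congr1 (pproj i)); rewrite qE pprojK ptmap_point /v clampK.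
  by move=> /angle_eq_point.
have qc := @angle_clamp_continuous R.
have v0 : v (clamp 0) = 0 \/ v (clamp 0) = 1 by apply: vend; rewrite c0.
have v1 : v (clamp 1) = 0 \/ v (clamp 1) = 1 by apply: vend; rewrite c1.
have angle01 (y : R) : y = 0 \/ y = 1 -> angle (clamp y) = point.
  by case=> ->; [exact: angle0|exact: angle1].
have gv0 := angle01 _ v0; have gv1 := angle01 _ v1.
pose g := circle_map (comp_continuous qc vc) gv0 gv1.
have gE r : g (angle r) = angle (clamp (v r)).
  exact: circle_map_angle gv0 gv1 r.
exists (pcomp (pcoproj i) g); last by move=> r; rewrite qE -gE.
rewrite -hcompE; case: Gsub => G1 _ GV.
have [->|->|->] := circle_arc_class vc gE v0 v1.
- by rewrite hcomp_pi1_one.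
- by rewrite hcomp1r; exact: Gcoproj.
- exact/GV/Gcoproj.
Qed.

Lemma wedge_nbhs_cases (p : R -> W) (x : R) : continuous p ->
  exists2 e : R, 0 < e &
    (forall r, `|r - x| < e -> wedge_bump (p r) < 3 / 16) \/
    (exists i, forall r, `|r - x| < e -> pproj i (p r) <> point).
Proof.
move=> pc.
have ball (A : set R) : open A -> A x ->
    exists2 e : R, 0 < e & forall r, `|r - x| < e -> A r.
  move=> Ao Ax; have /nbhs_ballP[e /= e0 eA] := open_nbhs_nbhs (conj Ao Ax).
  by exists e => // r rx; apply: eA; rewrite /ball /= distrC.
have pre (f : ptmap W R) (B : set R) : open B -> open [set r | B (f (p r))].
  move=> Bo; apply: (@open_comp _ _ (fun r => f (p r)) B) => // r _.
  exact: (comp_continuous (@ptmap_continuous _ _ f) pc).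
have [b|b] := ltP (wedge_bump (p x)) (3 / 16).
  have [e e0 eb] := ball _ (pre wedge_bump [set y | y < 3 / 16] (@open_lt _ _)) b.
  by exists e => //; left.
have [|i pi] := wedge_bump_gt0 (w := p x); first by lra.
pose f : ptmap W R := pcomp circle_bump (pproj i).
have [|e e0 eb] := ball _ (pre f [set y | 0 < y] (@open_gt _ _)); first exact/bump_gt0.
by exists e => //; right; exists i => r /eb /bump_gt0.
Qed.

(** Every class has a pinched representative, and [real_induction] cuts the
    latter into finitely many arcs to which [arc_in_cst] or [arc_in_circle]
    applies. *)
Lemma pi1_wedge_generated (a : pi1 R W) : G a.
Proof.
rewrite -(hcls_repr a); set f := repr a.
pose p (r : R) : W := f (angle (clamp r)).
have pc : continuous p.
  apply: (comp_continuous (@ptmap_continuous _ _ f)).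
  exact: angle_clamp_continuous.
pose q (r : R) : W := wedge_pinch (p r).
have qc : continuous q.
  exact: (comp_continuous (@ptmap_continuous _ _ wedge_pinch) pc).
(* At time t the loop q has been decomposed up to some time s, and since s the
   path p has not left the circle in which it was at that time. *)
pose Q (t : R) := exists s, [/\ 0 <= s <= t, q s = point, arc_in G q 0 s &
  s = t \/ exists i, forall r, s <= r <= t -> pproj i (p r) <> point].
have : Q 1.
  apply: real_induction.
    exists 0; split; [by rewrite lexx| |apply: arc_in_cst => // r|by left].
    - by rewrite /q /p angle0 !ptmap_point.
    - by move=> /andP[r0 r1]; rewrite (_ : r = 0) ?/q ?/p ?angle0 ?ptmap_point //; lra.
  move=> x; have [e e0 ex] := wedge_nbhs_cases x pc.
  exists e => // t t' t0 tt' tx t'x [s [/andP[s0 st] qs Gs sQ]].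
  have near r : t <= r <= t' -> `|r - x| < e.
    move=> /andP[tr rt']; move: tx t'x; rewrite !ltr_norml.
    by move=> /andP[? ?] /andP[? ?]; apply/andP; split; lra.
  case: ex => [flat|[i circ]].
    (* The path is back near the base point: the pending arc is closed. *)
    have qp r : t <= r <= t' -> q r = point.
      by move=> /near /flat /wedge_pinch_near_point.
    have qt : q t = point by apply: qp; rewrite lexx.
    exists t'; split; [by rewrite lexx andbT; lra| | |by left].
      by apply: qp; rewrite lexx tt'.
    have Gt : arc_in G q t t' by apply: arc_in_cst.
    apply: (arc_in_trans Gsub qc _ Gt).
    case: sQ => [<- //|[i si]].
    exact: (arc_in_trans Gsub qc Gs (arc_in_circle pc st si qs qt)).
  (* The path is off the base point: the pending arc, possibly empty so far, is
     prolonged, and it stays in the same circle because both contain p t. *)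
  exists s; split => //; first by rewrite s0 (le_trans st).
  right; exists i => r /andP[sr rt'].
  have [tr|rt] := leP t r; first by apply/circ/near; rewrite tr.
  case: sQ => [est|[j sj]]; first by move: rt; rewrite -est ltNge sr.
  have -> : i = j; last by apply: sj; rewrite sr ltW.
  apply: (@pproj_neq_inj i j (p t)); last by apply: sj; rewrite st lexx.
  by apply/circ/near; rewrite lexx.
(* No arc can be pending at time 1, when p is at the base point. *)
move=> [s [/andP[s0 s1] qs Gs [es|[i /(_ 1)]]]]; last first.
  rewrite s1 lexx => /(_ isT); rewrite /p angle1 !ptmap_point.
  by [].
subst s; case: Gs => g Gg gE.
rewrite -[hcls f]hcomp1l -wedge_pinch_hid hcompE.
rewrite (_ : pcomp wedge_pinch f = g) //; apply: ptmap_circle_eq => r.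
by rewrite gE add0r subr0 mulr1 /q /p clampK.
Qed.

End wedge_of_circles.

Theorem corollary3p13 (R : realType) (n : choiceType) :
  zeta_complete (full_aff R (copower n (circle R))).
Proof.
set X := full_aff R _.
pose el (a : pi1 R (copower n (circle R))) : set_type (aff_sub X) :=
  exist (fun x => x \in aff_sub X) a (mem_set I).
pose sec : hTop R X (aff_copower X) := copair (fun i => aff_coproj (el (coproj i))).
have JE (a : set_type (aff_sub X)) : aff_J (aff_coproj a).
  by move=> B [_ gB]; apply: gB; exists a.
have counitE (a : set_type (aff_sub X)) : hcomp (aff_counit X) (aff_coproj a) = val a.
  exact: copair_coproj.
have counit_sec : hcomp (aff_counit X) sec = hid X.
  apply: copair_unique => i.
  by rewrite -hcompA copair_coproj counitE hcomp1l.
have J_sub : is_subgroup (@aff_J R X).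
  split=> [|a b|a].
  - by move=> B [[]].
  - by move=> Ja Jb B B'; case: (B') => -[_ BM _] _; apply: BM; [exact: Ja|exact: Jb].
  - by move=> Ja B B'; case: (B') => -[_ _ BV] _; apply: BV; exact: Ja.
have secJ (a : pi1 R X) : aff_J (hcomp sec a).
  apply: (pi1_wedge_generated (is_subgroup_preimage sec J_sub)) => i /=.
  by rewrite copair_coproj; exact: JE.
split=> [Y g h gh|Y f fker].
  have {gh} : aff_map g = aff_map h by apply: copair_unique => i; exact: gh.
  case: g h => [g gP] [h hP] /= e; subst h.
  by rewrite (Prop_irrelevance gP hP).
exists (hcomp f sec); apply: copair_unique => a.
rewrite -!hcompA; apply: fker => //; first exact: JE.
by rewrite [in RHS]hcompA counit_sec hcomp1l.
Qed.
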